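(* Let $G$ be a group with a BN-pair $(B,N)$ with Weyl group $(W,S)$, such that $B$ is a commensurated subgroup of $G$ and $|S|<\infty$; given $J\subseteq S$, let $P_J$ be the standard parabolic subgroup $BW_JB$ of $G$. Let $J,J'\subseteq S$. Suppose $g\in G$ is such that $gP_Jg^{-1}$ is virtually contained in $P_{J'}$. Then $[W_J]\le[W_{J'}]$ as elements of $\Lambda^\infty_{(W,S)}$; we have $[W_J]=[W_{J'}]$ if and only if $gP_Jg^{-1}\sim_f P_{J'}$. Conversely, if $[W_J]\le[W_{J'}]$ then $P_J$ is virtually contained in $P_{J'}$.
   Context: A BN-pair in a group $G$ is a pair of subgroups $(B,N)$ with $G=\langle B,N\rangle$, $T=B\cap N$ normal in $N$, and such that $W=N/T$ has a generating set $S$ with $BwB\cdot BsB\subseteq BwB\cup BwsB$ and $sBs^{-1}\not\subseteq B$ for all $s\in S$, $w\in W$; $(W,S)$ is then a Coxeter system, the Weyl group of the BN-pair. For $J\subseteq S$, $W_J=\langle J\rangle$ (standard parabolic subgroup of $W$). For subgroups $H_1,H_2$ of a group, $H_1\sim_fH_2$ means that $H_1\cap H_2$ has finite index in both; $H_1$ is virtually contained in $H_2$ if $H_1\cap H_2$ has finite index in $H_1$. $B$ is commensurated in $G$ if $B\sim_f gBg^{-1}$ for all $g\in G$. $\Lambda_{(W,S)}$ is the set of standard parabolic subgroups of $W$ ordered by inclusion, and $\Lambda^\infty_{(W,S)}=\Lambda_{(W,S)}/\sim_f$ is the quotient poset, with $[W_J]$ the class of $W_J$; thus $[W_J]\le[W_{J'}]$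 iff there are standard parabolic subgroups $W_{J_1}\sim_fW_J$ and $W_{J_1'}\sim_fW_{J'}$ with $W_{J_1}\le W_{J_1'}$. *)

(* Defs.v *)
From HB Require Import structures.
From mathcomp Require Import all_boot.
From mathcomp Require Import boolp classical_sets functions cardinality.

Set Implicit Arguments.
Unset Strict Implicit.
Unset Printing Implicit Defensive.

Local Open Scope classical_set_scope.
Local Open Scope group_scope.

Section Subgroups.
Context {G : groupType}.
Implicit Types (A C H K T N : set G) (g x y : G).

Definition subgroup H : Prop := group_closed [in H].

Definition gen A : set G := smallest subgroup A.

Definition setM A C : set G := [set x * y | x in A & y in C].
Definition setV A : set G := [set x^-1 | x in A].
Definition lcoset x A : set G := [set x * y | y in A].

(* g A g^-1; MathComp's x ^ g is g^-1 x g instead. *)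
Definition conjugate g A : set G := [set g * x * g^-1 | x in A].

Definition normal T N : Prop :=
  [/\ subgroup T, subgroup N, T `<=` N &
      forall n, N n -> conjugate n T `<=` T].

(* Intended for subgroups K `<=` H: finitely many cosets hK, h in H. *)
Definition finite_index K H : Prop :=
  finite_set [set lcoset h K | h in H].

Definition virtually_contained H K : Prop := finite_index (H `&` K) H.

Definition commensurable H K : Prop :=
  finite_index (H `&` K) H /\ finite_index (H `&` K) K.

Definition commensurated H : Prop :=
  forall g, commensurable H (conjugate g H).

Lemma subgroupP H :
  subgroup H <-> H 1 /\ forall x y, H x -> H y -> H (x / y).
Proof.
split=> [[H1 HF]|[H1 HF]].
  split=> [|x y Hx Hy]; first by apply/set_mem.
  by apply/set_mem/HF; apply/mem_set.
split; first exact/mem_set.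
by move=> x y /set_mem Hx /set_mem Hy; apply/mem_set/HF.
Qed.

Lemma subgroup_1 H : subgroup H -> H 1.
Proof. by case/subgroupP. Qed.

Lemma subgroup_V H x : subgroup H -> H x -> H x^-1.
Proof. by case/subgroupP=> H1 HF Hx; rewrite -div1g; apply: HF. Qed.

Lemma subgroup_M H x y : subgroup H -> H x -> H y -> H (x * y).
Proof.
move=> sH Hx Hy; have Hy' := subgroup_V sH Hy.
by case/subgroupP: sH => _ HF; rewrite -[y]invgK; apply: HF.
Qed.

Lemma setMA A C H : setM A (setM C H) = setM (setM A C) H.
Proof.
apply/seteqP; split=> [_ [x Ax [_ [y Cy [z Hz <-] <-]]]|_ [_ [x Ax [y Cy <-] [z Hz <-]]]].
  by exists (x * y); [exists x => //; exists y | exists z; rewrite ?mulgA].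
by exists x => //; exists (y * z); [exists y => //; exists z | rewrite mulgA].
Qed.

Lemma normalJ T N n t : normal T N -> N n -> T t -> T (n^-1 * t * n).
Proof.
move=> [sT sN sTN nTN] Nn Tt.
by apply: (nTN n^-1 (subgroup_V sN Nn)); exists t; rewrite ?invgK.
Qed.

Lemma lcosetM T N m n : normal T N -> N m -> N n ->
  setM (lcoset m T) (lcoset n T) = lcoset (m * n) T.
Proof.
move=> nT Nm Nn; have [sT _ _ _] := nT.
apply/seteqP; split=> [_ [_ [t Tt <-] [_ [u Tu <-] <-]]|_ [t Tt <-]].
  exists (n^-1 * t * n * u); first by apply: subgroup_M => //; apply: normalJ nT _ _.
  by rewrite !mulgA mulgK.
exists m; first by exists 1; [exact: subgroup_1|rewrite mulg1].
by exists (n * t); [exists t|rewrite mulgA].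
Qed.

Lemma lcosetV T N n : normal T N -> N n ->
  setV (lcoset n T) = lcoset n^-1 T.
Proof.
move=> nT Nn; have [sT sN _ nTN] := nT.
apply/seteqP; split=> [_ [_ [t Tt <-] <-]|_ [t Tt <-]].
  exists (n * t^-1 * n^-1).
    by apply: (nTN n) => //; exists t^-1 => //; apply: subgroup_V.
  by rewrite !mulgA mulVg mul1g invgM.
exists (n * (n^-1 * t^-1 * n)).
  by exists (n^-1 * t^-1 * n) => //; apply: normalJ nT _ _ => //; apply: subgroup_V.
by rewrite !mulgA mulgV mul1g invgM invgK.
Qed.

End Subgroups.

Section Quotient.
Context {G : groupType} {T N : set G}.

Definition lcosets : set (set G) := [set lcoset n T | n in N].

(* The quotient group N/T: its elements are the cosets nT, as subsets of G. *)
Record quotient (nTN : normal T N) := Quotient {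
  quotient_set :> set G;
  quotientP : quotient_set \in lcosets }.

Variable nTN : normal T N.

HB.instance Definition _ := [isSub for @quotient_set nTN].
HB.instance Definition _ := [Choice of quotient nTN by <:].

Implicit Types u v w : quotient nTN.

Lemma quotient_one_subproof : T \in lcosets.
Proof.
have [_ sN _ _] := nTN.
apply/mem_set; exists 1; first exact: subgroup_1.
by apply/seteqP; split=> [_ [t Tt <-]|t Tt]; [|exists t]; rewrite ?mul1g.
Qed.
Definition quotient_one : quotient nTN := Quotient nTN quotient_one_subproof.

Lemma quotient_mul_subproof u v : setM u v \in lcosets.
Proof.
case: u v => [? /= /set_mem [m Nm <-]] [? /= /set_mem [n Nn <-]].
have [_ sN _ _] := nTN.
apply/mem_set; exists (m * n); first exact: subgroup_M.
by rewrite (lcosetM nTN).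
Qed.
Definition quotient_mul u v : quotient nTN :=
  Quotient nTN (quotient_mul_subproof u v).

Lemma quotient_inv_subproof u : setV u \in lcosets.
Proof.
case: u => [? /= /set_mem [n Nn <-]]; have [_ sN _ _] := nTN.
apply/mem_set; exists n^-1; first exact: subgroup_V.
by rewrite (lcosetV nTN).
Qed.
Definition quotient_inv u : quotient nTN :=
  Quotient nTN (quotient_inv_subproof u).

Lemma quotient_mulA : associative quotient_mul.
Proof. by move=> u v w; apply: val_inj; rewrite /= setMA. Qed.

Lemma lcoset1 : lcoset 1 T = T.
Proof. by apply/seteqP; split=> [_ [t Tt <-]|t Tt]; [|exists t]; rewrite ?mul1g. Qed.

Lemma quotient_mul1 : left_id quotient_one quotient_mul.
Proof.
case=> X XN; apply: val_inj => /=; move: XN => /set_mem [n Nn <-].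
have [_ sN _ _] := nTN.
by rewrite -{1}lcoset1 (lcosetM nTN) ?mul1g //; apply: subgroup_1.
Qed.

Lemma quotient_1mul : right_id quotient_one quotient_mul.
Proof.
case=> X XN; apply: val_inj => /=; move: XN => /set_mem [n Nn <-].
have [_ sN _ _] := nTN.
by rewrite -{2}lcoset1 (lcosetM nTN) ?mulg1 //; apply: subgroup_1.
Qed.

Lemma quotient_mulV : left_inverse quotient_one quotient_inv quotient_mul.
Proof.
case=> X XN; apply: val_inj => /=; move: XN => /set_mem [n Nn <-].
have [_ sN _ _] := nTN.
by rewrite (lcosetV nTN) // (lcosetM nTN) ?mulVg ?lcoset1 //; apply: subgroup_V.
Qed.

Lemma quotient_mulrV : right_inverse quotient_one quotient_inv quotient_mul.
Proof.
case=> X XN; apply: val_inj => /=; move: XN => /set_mem [n Nn <-].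
have [_ sN _ _] := nTN.
by rewrite (lcosetV nTN) // (lcosetM nTN) ?mulgV ?lcoset1 //; apply: subgroup_V.
Qed.

HB.instance Definition _ := isGroup.Build (quotient nTN)
  quotient_mulA quotient_mul1 quotient_1mul quotient_mulV quotient_mulrV.

End Quotient.

Section BNPair.
Context {G : groupType} {B N : set G} {nT : normal (B `&` N) N}.

Local Notation W := (quotient nT).

Implicit Types (w s : W) (J S : set W) (C D : set (set W)).

Definition double_coset w : set G := setM B (setM w B).

(* s * s = 1 is part of Tits' axioms, and is used implicitly in writing the
   last axiom with s B s^-1: without it, G = Z[1/2] ><| <s> with B = Z,
   N = <s> and s b s^-1 = b / 2 would qualify, although (<s>, {s}) is not a
   Coxeter system and B W B is not a subgroup.  As s = nT with T contained in
   B, the product of sets s B s^-1 is n B n^-1. *)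
Definition bn_pair S : Prop :=
  [/\ subgroup B, gen (B `|` N) = setT, gen S = setT &
      [/\ forall s, S s -> s * s = 1,
          forall w s, S s ->
            setM (double_coset w) (double_coset s)
              `<=` double_coset w `|` double_coset (w * s) &
          forall s, S s -> ~ (setM (setM s B) s^-1%g `<=` B)]].

(* P_J = B W_J B *)
Definition std_parabolic J : set G := \bigcup_(w in gen J) double_coset w.

Definition std_parabolics S : set (set W) :=
  [set gen J | J in [set J | J `<=` S]].

(* The class [H] of H for ~_f in the poset of standard parabolics of (W, S). *)
Definition class_of S (H : set W) : set (set W) :=
  [set K | std_parabolics S K /\ commensurable K H].

Definition class_le C D : Prop := exists H K, [/\ C H, D K & H `<=` K].

End BNPair.

(* Main.v *)
Require Import Defs.
From mathcomp Require Import all_boot.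
From mathcomp Require Import boolp classical_sets functions cardinality.

(** Virtual containment of x^-1 H x in K says that H x K is a finite union of
    left cosets of K.  This condition composes, [coset_finite_trans], and is
    insensitive to replacing x by another element of H x K, so all three claims
    can be phrased and combined in these terms, in G and in W alike.

    From G to W.  As B is commensurated, each double coset B w B is a finite
    union of cosets of B; distinct w give disjoint double cosets; and if w is
    shortest in W_J w then P_J w P_J' is the union of the B v B with v in
    W_J w W_J'.  So virtual containment of g P_J g^-1 in P_J', with g^-1 in
    B w B, is equivalent to virtual containment of w^-1 W_J w in W_J'
    ([coset_finite_std_parabolic]).

    In W.  Shrink J to a subset I that is minimal with W_I of finite index in
    W_J, and let x be shortest in W_I w W_J'.  The intersection of W_I with
    x W_J' x^-1 is then generated by a subset of I ([gen_cap_conj]); it has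
    finite index in W_I, so by minimality x^-1 I x is contained in J'.  The
    crux is that in fact x^-1 I x = I ([tight_conjugate]): a minimal I has no
    spherical component, and such subsets are only conjugate to themselves.
    Hence I lies in J and in J', which gives [W_J] = [W_I] <= [W_J'], and x
    normalises W_I.  If moreover [W_J] = [W_J'], then W_I has finite index in
    W_J' as well, and since x normalises it the containment can be reversed:
    that is the equality case.  The converse claims follow from composition.

    The Coxeter theory needed, up to the Bruhat order and Kilmoyer's theorem on
    intersections of parabolic subgroups, is developed from Tits' axioms for
    half-spaces, which the product rule for double cosets gives directly. *)

Local Open Scope classical_set_scope.

Set Implicit Arguments.
Unset Strict Implicit.
Unset Printing Implicit Defensive.

(** * Double cosets meeting finitely many cosets *)

(* Left-associated form of a word, freely reduced. *)
Ltac gsimp :=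
  rewrite ?(mulgA, invgM, invgK, invg1, mul1g, mulg1, mulgK, mulgVK, mulVg, mulgV)%g.

Lemma finite_image_factor (T U V : Type) (A : set T) (f : T -> U) (g : T -> V) :
  (forall x y, A x -> A y -> f x = f y -> g x = g y) ->
  finite_set (f @` A) -> finite_set (g @` A).
Proof.
move=> fg finf.
have [-> | /set0P [x0 Ax0]] := eqVneq A set0; first by rewrite image_set0.
pose h u := if pselect (exists2 x, A x & f x = u) is left e
            then g (projT1 (cid2 e)) else g x0.
apply: (sub_finite_set _ (finite_image h finf)) => _ [x Ax <-].
exists (f x); first by exists x.
rewrite /h; case: pselect => [e|[]]; last by exists x.
by case: cid2 => y Ay fyx /=; apply: fg.
Qed.

Lemma finite_set_uniqP (T : eqType) (A : set T) : finite_set A ->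
  exists2 l : seq T, uniq l & A = [set` l].
Proof.
move=> /finite_seqP [l ->]; exists (undup l); first exact: undup_uniq.
by apply/seteqP; split=> x /=; rewrite mem_undup.
Qed.

Lemma image_seq (T U : eqType) (f : T -> U) (l : seq T) :
  f @` [set` l] = [set` map f l].
Proof.
apply/seteqP; split=> [_ [x xl <-]|_ /mapP [x xl ->]] /=; last by exists x.
exact: map_f.
Qed.

Lemma setU1_seq (T : eqType) (x : T) (l : seq T) : x |` [set` l] = [set` x :: l].
Proof.
apply/seteqP; split=> y /=; rewrite inE; last by case/orP=> [/eqP|]; [left|right].
by case=> [->|yl]; apply/orP; [left | right].
Qed.

Lemma finite_image_exchange (T : eqType) (A : set T) (f : T -> T) s :
  finite_set A -> injective f -> ~ A s -> f @` A `<=` s |` A ->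
  exists2 r, ~ (f @` A) r & s |` A = r |` f @` A.
Proof.
move=> /finite_set_uniqP [l ul ->] inj_f /negP sl; rewrite image_seq => sub.
have ufl : uniq (map f l) by rewrite map_inj_uniq.
have [r rsl rfl] : exists2 r, r \in s :: l & r \notin map f l.
  apply/hasP; apply: contraT; rewrite -all_predC => /allP out.
  have: (size (s :: l) <= size (map f l))%N.
    apply: uniq_leq_size => [|x /out /=]; first by rewrite /= sl.
    by rewrite negbK.
  by rewrite size_map ltnn.
exists r; first exact/negP.
have [|x||_ E] := @uniq_min_size _ (r :: map f l) (s :: l).
- by rewrite /= rfl.
- rewrite inE => /orP [/eqP -> //|/sub [->|xl]]; first exact: mem_head.
  by rewrite inE; apply/orP; right.
- by rewrite /= size_map.
by rewrite !setU1_seq; apply/seteqP; split=> x /=; rewrite E.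
Qed.

Lemma finite_image_sub_eq (T : eqType) (A : set T) (f : T -> T) :
  finite_set A -> A `<=` f @` A -> f @` A = A.
Proof.
move=> /finite_set_uniqP [l ul ->]; rewrite image_seq => sub.
have [|_ E] := uniq_min_size ul sub; first by rewrite size_map.
by apply/seteqP; split=> x /=; rewrite E.
Qed.

Section CosetFiniteness.
Local Open Scope group_scope.
Context {G : groupType}.
Implicit Types (A H K L : set G) (x y g : G).

Lemma gen_subgroup A : subgroup (gen A).
Proof.
apply/subgroupP; split=> [H [sH _]|x y Ax Ay H HA]; first exact: subgroup_1.
by case: (HA) => sH _; apply: subgroup_M (Ax _ HA) (subgroup_V sH (Ay _ HA)).
Qed.

Lemma gen_sub A H : subgroup H -> A `<=` H -> gen A `<=` H.
Proof. exact: smallest_sub. Qed.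

Lemma subset_gen A : A `<=` gen A.
Proof. exact: sub_gen_smallest. Qed.

Lemma genS A1 A2 : A1 `<=` A2 -> gen A1 `<=` gen A2.
Proof.
by move=> sA; apply: gen_sub; [exact: gen_subgroup | move=> x /sA /subset_gen].
Qed.

Lemma subgroupI H K : subgroup H -> subgroup K -> subgroup (H `&` K).
Proof.
move=> /subgroupP [H1 HF] /subgroupP [K1 KF]; apply/subgroupP.
by split=> // x y [Hx Kx] [Hy Ky]; split; [apply: HF | apply: KF].
Qed.

Lemma conjugateE g A x : conjugate g A x <-> A (g^-1 * x * g).
Proof.
split=> [[y Ay <-]|Ax]; first by gsimp.
by exists (g^-1 * x * g) => //; gsimp.
Qed.

Lemma subgroup_conjugate g H : subgroup H -> subgroup (conjugate g H).
Proof.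
move=> /subgroupP [H1 HF]; apply/subgroupP.
split=> [|x y /conjugateE Hx /conjugateE Hy]; apply/conjugateE; first by gsimp.
by have := HF _ _ Hx Hy; gsimp.
Qed.

Lemma lcoset_eqP K x y : subgroup K ->
  lcoset x K = lcoset y K <-> K (x^-1 * y).
Proof.
move=> sK; split=> [exy|Kxy].
  have: lcoset y K y by exists 1; [exact: subgroup_1 | rewrite mulg1].
  by rewrite -exy => -[k Kk <-]; gsimp.
apply/seteqP; split=> [_ [k Kk <-]|_ [k Kk <-]].
  exists ((x^-1 * y)^-1 * k); last by gsimp.
  by apply: subgroup_M => //; apply: subgroup_V.
by exists (x^-1 * y * k); [apply: subgroup_M | gsimp].
Qed.

(** Virtual containment of x^-1 H x in K, without mention of an intersection:
    in this form it composes like the arrows of a category. *)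
Definition coset_finite H x K : Prop :=
  finite_set [set lcoset (h * x) K | h in H].

Lemma coset_finite_sub H x K : subgroup K ->
  (forall h, H h -> K (x^-1 * h * x)) -> coset_finite H x K.
Proof.
move=> sK HK; apply: (@sub_finite_set _ _ [set lcoset x K]) (finite_set1 _).
by move=> _ [h Hh <-] /=; apply/lcoset_eqP => //; have := subgroup_V sK (HK _ Hh); gsimp.
Qed.

Lemma coset_finite1 H K : subgroup K -> H `<=` K -> coset_finite H 1 K.
Proof. by move=> sK HK; apply: coset_finite_sub => // h /HK; gsimp. Qed.

(** H x K y L is covered by finitely many h x K y L, and each of these by
    finitely many cosets of L. *)
Lemma coset_finite_trans H x K y L : subgroup K -> subgroup L ->
  coset_finite H x K -> coset_finite K y L -> coset_finite H (x * y) L.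
Proof.
move=> sK sL HK KL.
pose E X := [set lcoset (z * y) L | z in X].
apply: (@sub_finite_set _ _
  (\bigcup_(X in [set lcoset (h * x) K | h in H]) E X)).
  move=> _ [h Hh <-]; exists (lcoset (h * x) K); first by exists h.
  exists (h * x); last by gsimp.
  by exists 1; [exact: subgroup_1 | rewrite mulg1].
apply: bigcup_finite => // _ [h Hh <-].
have -> : E (lcoset (h * x) K) =
    [set [set h * x * z | z in X] | X in [set lcoset (k * y) L | k in K]].
  apply/seteqP; split=> [_ [_ [k Kk <-] <-]|_ [_ [k Kk <-] <-]].
    exists (lcoset (k * y) L); first by exists k.
    apply/seteqP; split=> [_ [_ [l Ll <-] <-]|_ [l Ll <-]].
      by exists l => //; gsimp.
    by exists (k * y * l); [exists l | gsimp].
  exists (h * x * k); first by exists k.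
  apply/seteqP; split=> [_ [l Ll <-]|_ [_ [l Ll <-] <-]].
    by exists (k * y * l); [exists l | gsimp].
  by exists l => //; gsimp.
exact: finite_image.
Qed.

Lemma coset_finite_shift H a x b K : subgroup H -> subgroup K -> H a -> K b ->
  coset_finite H (a * x * b) K <-> coset_finite H x K.
Proof.
move=> sH sK Ha Kb.
have shift a' x' b' : H a' -> K b' ->
    coset_finite H x' K -> coset_finite H (a' * x' * b') K.
  move=> Ha' Kb' fx; apply: (@coset_finite_trans _ _ K) => //.
    apply: (@coset_finite_trans _ _ H) => //; apply: coset_finite_sub => // h Hh.
    by apply: subgroup_M => //; apply: subgroup_M => //; apply: subgroup_V.
  apply: coset_finite_sub => // h Kh.
  by apply: subgroup_M => //; apply: subgroup_M => //; apply: subgroup_V.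
split; last exact: shift.
by move=> /(shift a^-1 _ b^-1 (subgroup_V sH Ha) (subgroup_V sK Kb)); gsimp.
Qed.

Lemma coset_finite_cap H x K K0 : subgroup H -> subgroup K -> subgroup K0 ->
  (forall h, H h -> K (x^-1 * h * x) -> K0 h) ->
  coset_finite H x K -> coset_finite H 1 K0.
Proof.
move=> sH sK sK0 cap; apply: finite_image_factor => h h' Hh Hh'.
rewrite !lcoset_eqP // !mulg1 => Kh; apply: cap; last by move: Kh; gsimp.
by apply: subgroup_M => //; apply: subgroup_V.
Qed.

Lemma gen_conjugate g A h : gen A h -> gen (conjugate g A) (g * h * g^-1).
Proof.
pose K := conjugate g^-1 (gen (conjugate g A)).
suff AK : gen A `<=` K by move=> /AK /conjugateE; gsimp.
apply: gen_sub; first exact/subgroup_conjugate/gen_subgroup.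
move=> x Ax; apply/conjugateE; gsimp; apply: subset_gen.
by apply/conjugateE; gsimp.
Qed.

Lemma conjugate1 H : conjugate 1 H = H.
Proof. by apply/seteqP; split=> x; rewrite conjugateE; gsimp. Qed.

Lemma conjugateM g h A : conjugate g (conjugate h A) = conjugate (g * h) A.
Proof. by apply/seteqP; split=> x; rewrite !conjugateE; gsimp. Qed.

(** An orbit is finite when the stabiliser of a point has finite index. *)
Lemma finite_index_coset_finite C H x K : subgroup C -> subgroup H -> subgroup K ->
  (forall h, H h -> C h <-> K (x^-1 * h * x)) ->
  finite_index C H <-> coset_finite H x K.
Proof.
move=> sC sH sK CK.
have E h h' : H h -> H h' ->
    lcoset h C = lcoset h' C <-> lcoset (h * x) K = lcoset (h' * x) K.
  move=> Hh Hh'; rewrite !lcoset_eqP // CK; first by gsimp.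
  by apply: subgroup_M => //; apply: subgroup_V.
by split; apply: finite_image_factor => h h' Hh Hh' /E; apply.
Qed.

Lemma virtually_contained_conjugateE H K g : subgroup H -> subgroup K ->
  virtually_contained (conjugate g H) K <-> coset_finite H g^-1 K.
Proof.
move=> sH sK; have sgH := subgroup_conjugate g sH.
have -> : coset_finite H g^-1 K <-> coset_finite (conjugate g H) 1 K.
  split=> f.
    rewrite -(mulgV g); apply: (@coset_finite_trans _ _ H) => //.
    by apply: coset_finite_sub => // x /conjugateE.
  rewrite -(mulg1 g^-1); apply: (@coset_finite_trans _ _ (conjugate g H)) => //.
  by apply: coset_finite_sub => // x Hx; apply/conjugateE; gsimp.
apply: finite_index_coset_finite => //; first exact: subgroupI.
by move=> h gHh; gsimp; split=> [[]|].
Qed.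

Lemma virtually_containedE H K : subgroup H -> subgroup K ->
  virtually_contained H K <-> coset_finite H 1 K.
Proof.
by move=> sH sK; rewrite -{1}(conjugate1 H) virtually_contained_conjugateE // invg1.
Qed.

Lemma commensurableE H K : subgroup H -> subgroup K ->
  commensurable H K <-> coset_finite H 1 K /\ coset_finite K 1 H.
Proof.
move=> sH sK; rewrite -(virtually_containedE sH sK) -(virtually_containedE sK sH).
by rewrite /commensurable /virtually_contained (setIC K H).
Qed.

Lemma commensurable_conjugateE H K g : subgroup H -> subgroup K ->
  commensurable (conjugate g H) K <->
  coset_finite H g^-1 K /\ coset_finite K g H.
Proof.
move=> sH sK; have sgH := subgroup_conjugate g sH.
rewrite commensurableE // -virtually_containedE // virtually_contained_conjugateE //.
suff -> : coset_finite K 1 (conjugate g H) <-> coset_finite K g H by [].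
split=> f.
  rewrite -(mul1g g); apply: (@coset_finite_trans _ _ (conjugate g H)) => //.
  by apply: coset_finite_sub => // x /conjugateE.
rewrite -(mulgV g); apply: (@coset_finite_trans _ _ H) => //.
by apply: coset_finite_sub => // x Hx; apply/conjugateE; gsimp.
Qed.

Lemma commensurated_coset_finite H g : subgroup H -> commensurated H ->
  coset_finite H g H.
Proof.
move=> sH /(_ g) [f _]; move: f.
have sgH := subgroup_conjugate g sH.
rewrite -/(virtually_contained H (conjugate g H)) => f.
rewrite -(mul1g g); apply: (@coset_finite_trans _ _ (conjugate g H)) => //.
  by apply/virtually_containedE.
by apply: coset_finite_sub => // x /conjugateE.
Qed.

End CosetFiniteness.
(** * Groups generated by involutions: words and length *)

Section Words.
Local Open Scope group_scope.
Context {W : groupType}.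
Implicit Types (J S : set W) (l : seq W) (s w x y : W).

Definition wprod l : W := \prod_(x <- l) x.

Lemma wprod_nil : wprod [::] = 1. Proof. exact: big_nil. Qed.

Lemma wprod_cons s l : wprod (s :: l) = s * wprod l.
Proof. exact: big_cons. Qed.

Lemma wprod_cat l1 l2 : wprod (l1 ++ l2) = wprod l1 * wprod l2.
Proof. exact: big_cat. Qed.

Lemma wprod1 s : wprod [:: s] = s.
Proof. exact: big_seq1. Qed.

Lemma wprod_gen J l : all [in J] l -> gen J (wprod l).
Proof.
elim: l => [_|s l IH /= /andP [/set_mem Js /IH Jl]].
  by rewrite wprod_nil; exact: subgroup_1 (gen_subgroup J).
rewrite wprod_cons; exact: subgroup_M (gen_subgroup J) (subset_gen Js) Jl.
Qed.

Lemma wprod_rev l : (forall s, s \in l -> s^-1 = s) -> wprod (rev l) = (wprod l)^-1.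
Proof.
elim: l => [_|s l IH inv]; first by rewrite wprod_nil invg1.
rewrite rev_cons -cats1 wprod_cat wprod1 wprod_cons invgM (inv s) ?mem_head // IH //.
by move=> x xl; apply: inv; rewrite inE xl orbT.
Qed.

Section Involutions.
Context {S : set W}.
Hypothesis invS : forall s, S s -> s * s = 1.

Lemma invol_inv s : S s -> s^-1 = s.
Proof. by move=> /invS /mulg1_eq. Qed.

Lemma involK s w : S s -> s * (s * w) = w.
Proof. by move=> /invS ss; rewrite mulgA ss mul1g. Qed.

Lemma gen_wordP J w : J `<=` S -> gen J w <-> exists2 l, all [in J] l & w = wprod l.
Proof.
move=> JS; split=> [|[l Jl ->]]; last exact: wprod_gen.
move=> Jw; apply: (@gen_sub _ J [set w | exists2 l, all [in J] l & w = wprod l]) Jw.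
  apply/subgroupP; split=> [|_ _ [l1 J1 ->] [l2 J2 ->]].
    by exists [::]; rewrite ?wprod_nil.
  exists (l1 ++ rev l2); first by rewrite all_cat all_rev J1.
  rewrite wprod_cat wprod_rev // => x /(allP J2) /set_mem /JS; exact: invol_inv.
by move=> s Js; exists [:: s]; rewrite ?wprod1 //= andbT; apply/mem_set.
Qed.

(** Words of minimal length among the words in J, a notion which a priori
    depends on J; see [minword_reduced]. *)
Definition minword J l : Prop :=
  all [in J] l /\
  forall l', all [in J] l' -> wprod l' = wprod l -> (size l <= size l')%N.

Lemma minwordP J w : J `<=` S -> gen J w -> exists2 l, minword J l & w = wprod l.
Proof.
move=> JS /(gen_wordP _ JS) [l0 J0 w0].
pose P n := `[< exists l, [/\ all [in J] l, w = wprod l & size l = n] >].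
have exP : exists n, P n by exists (size l0); apply/asboolP; exists l0.
case: (ex_minnP exP) => n /asboolP [l [Jl wl <-]] min.
exists l => //; split=> // l' Jl' wl'; apply: min; apply/asboolP.
by exists l'; split=> //; rewrite wl' wl.
Qed.

Lemma minword_behead J s l : minword J (s :: l) -> minword J l.
Proof.
case=> /= /andP [Js Jl] min; split=> // l' Jl' e.
by have := min (s :: l'); rewrite /= Js Jl' !wprod_cons e; apply.
Qed.

End Involutions.

Definition len S w : nat :=
  xget 0%N [set size l | l in [set l | minword S l /\ w = wprod l]].

Section Length.
Context {S : set W}.
Hypotheses (genW : gen S = setT) (invS : forall s, S s -> s * s = 1).
Local Notation len := (len S).

Lemma len_word w : exists2 l, minword S l & w = wprod l /\ size l = len w.
Proof.
have [l ml wl] := minwordP invS (@subset_refl _ S) (eq_ind_r (@^~ w) I genW).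
rewrite /len; case: xgetP => [_ -> [l' [ml' ->] <-]|no]; first by exists l'.
by case: (no (size l)); exists l.
Qed.

Lemma len_le l : all [in S] l -> (len (wprod l) <= size l)%N.
Proof. by move=> Sl; have [l' [_ min] [e <-]] := len_word (wprod l); apply: min. Qed.

Lemma len_reduced l : minword S l -> len (wprod l) = size l.
Proof.
move=> [Sl min]; apply/eqP; rewrite eqn_leq len_le //=.
by have [l' [Sl' _] [e <-]] := len_word (wprod l); apply: min.
Qed.

Lemma len1 : len 1 = 0%N.
Proof. by have := @len_le [::] isT; rewrite wprod_nil; case: len. Qed.

Lemma len_eq0 w : len w = 0%N -> w = 1.
Proof. by have [l _ [-> <-]] := len_word w => /size0nil ->; rewrite wprod_nil. Qed.

Lemma len_mul x y : (len (x * y) <= len x + len y)%N.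
Proof.
have [l1 [S1 _] [-> <-]] := len_word x; have [l2 [S2 _] [-> <-]] := len_word y.
by rewrite -size_cat -wprod_cat; apply: len_le; rewrite all_cat S1.
Qed.

Lemma lenV w : len w^-1 = len w.
Proof.
suff H x : (len x^-1 <= len x)%N.
  by apply/eqP; rewrite eqn_leq H -{1}(invgK w) H.
have [l [Sl _] [-> <-]] := len_word x.
rewrite -wprod_rev; first by rewrite -size_rev; apply: len_le; rewrite all_rev.
by move=> s /(allP Sl) /set_mem; apply: invol_inv.
Qed.

Lemma len_gen s : S s -> (len s <= 1)%N.
Proof.
by move=> Ss; rewrite -(wprod1 s); apply: len_le; rewrite /= andbT; apply/mem_set.
Qed.

Lemma len_mulr w s : S s -> (len (w * s) <= (len w).+1)%N.
Proof.
by move=> /len_gen ls; apply: leq_trans (len_mul _ _) _; rewrite -addn1 leq_add2l.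
Qed.

Lemma len_mull s w : S s -> (len (s * w) <= (len w).+1)%N.
Proof.
by move=> /len_gen ls; apply: leq_trans (len_mul _ _) _; rewrite -add1n leq_add2r.
Qed.

Lemma exists_left_descent w : w <> 1 ->
  exists s u, [/\ S s, w = s * u & len w = (len u).+1].
Proof.
have [[|s l] ml [-> _]] := len_word w; first by rewrite wprod_nil.
have [/andP [/set_mem Ss _] _] := ml.
move=> _; exists s, (wprod l); rewrite wprod_cons; split=> //.
have ml' : minword S l by apply: minword_behead ml.
by rewrite -wprod_cons !len_reduced.
Qed.

Lemma finite_ball n : finite_set S -> finite_set [set w | (len w <= n)%N].
Proof.
move=> finS; elim: n => [|n IH].
  apply: sub_finite_set (finite_set1 1) => w /=.
  by rewrite leqn0 => /eqP /len_eq0.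
apply: (@sub_finite_set _ _
  ([set 1] `|` [set s * u | s in S & u in [set w | (len w <= n)%N]])).
  move=> w /=; have [->|/eqP w1] := eqVneq w 1; first by left.
  have [s [u [Ss wE ->]]] := exists_left_descent w1.
  by rewrite ltnS => lu; right; exists s => //; exists u.
by rewrite finite_setU; split; [exact: finite_set1 | exact: finite_image2 finS IH].
Qed.

End Length.
End Words.
(** * Exchange, reflections and Bruhat order *)

Section Folding.
Local Open Scope group_scope.
Context {W : groupType}.
Implicit Types (I J K L : set W) (l : seq W) (a b s t u v w x y z : W).

(** Tits' presentation of Coxeter groups by half-spaces: pos s w means that the
    chamber w lies on the same side as 1 of the wall fixed by s, and the last
    clause says that an edge crossing this wall is reversed by s.  In this form
    the axioms can be read off directly from a BN-pair. *)
Definition folding_system (S : set W) (pos : W -> W -> Prop) : Prop :=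
  [/\ gen S = setT,
      forall s, S s -> s * s = 1,
      forall s, S s -> pos s 1,
      forall s w, S s -> pos s w -> ~ pos s (s * w) &
      forall s s' w, S s -> S s' -> pos s w -> ~ pos s (w * s') ->
        s * w = w * s'].

Context {S : set W} {pos : W -> W -> Prop}.
Hypothesis sys : folding_system S pos.
Local Notation len := (len S).

Let genW : gen S = setT. Proof. by case: sys. Qed.
Let invS : forall s, S s -> s * s = 1. Proof. by case: sys. Qed.
Let pos1 s : S s -> pos s 1. Proof. by case: sys => _ _ + _ _; apply. Qed.

Lemma gen_neq1 s : S s -> s <> 1.
Proof.
case: sys => _ _ _ posN _ Ss s1.
by apply: (posN s 1 Ss (pos1 Ss)); rewrite mulg1 {2}s1; apply: pos1.
Qed.

(** Among the edges w -- w a, the wall of the reflection y s y^-1 is crossed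
    only by those which the reflection reverses. *)
Lemma cross_edge y s a w : S s -> S a ->
  ~ (pos s (y^-1 * w) <-> pos s (y^-1 * (w * a))) ->
  y * s * y^-1 * w = w * a.
Proof.
case: sys => _ _ _ _ fold Ss Sa.
have [p|np] := pselect (pos s (y^-1 * w));
  have [q|nq] := pselect (pos s (y^-1 * (w * a))) => nE; try by case: nE.
- by have := fold s a _ Ss Sa p; rewrite -!mulgA => /(_ nq) ->; gsimp.
- have := fold s a _ Ss Sa q; rewrite -!mulgA invS // mulg1 => /(_ np) e.
  by rewrite -e (involK invS) //; gsimp.
Qed.

(** Strong exchange: along a gallery changing sides, one edge is crossed, and
    reflecting the part of the gallery beyond it skips that edge. *)
Lemma cross_gallery J y s w l : J `<=` S -> S s -> all [in J] l ->
  ~ (pos s (y^-1 * w) <-> pos s (y^-1 * (w * wprod l))) ->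
  exists l', [/\ all [in J] l', size l = (size l').+1 &
    y * s * y^-1 * (w * wprod l) = w * wprod l'].
Proof.
move=> JS Ss; elim: l w => [|a l IH] w; first by rewrite wprod_nil mulg1 => _ [].
move=> /= /andP [Ja Jl] nE; have Sa := JS _ (set_mem Ja).
have [E|/(cross_edge Ss Sa) e] :=
    pselect (pos s (y^-1 * w) <-> pos s (y^-1 * (w * a))).
  have [|l' [Jl' -> e]] := IH (w * a) Jl.
    by rewrite -E; move: nE; rewrite wprod_cons; gsimp.
  exists (a :: l'); rewrite /= Ja; split=> //; move: e.
  by rewrite !(wprod_cons a); gsimp.
exists l; split=> //.
by rewrite mulgA e wprod_cons -!mulgA (involK invS).
Qed.

Lemma exchange J s w l : J `<=` S -> S s -> all [in J] l ->
  pos s w -> ~ pos s (w * wprod l) ->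
  exists l', [/\ all [in J] l', size l = (size l').+1 &
    s * (w * wprod l) = w * wprod l'].
Proof.
move=> JS Ss Jl p np; have [|l' [Jl' lE e]] := @cross_gallery J 1 s w l JS Ss Jl.
  by gsimp => -[/(_ p)].
by exists l'; split=> //; move: e; gsimp.
Qed.

Lemma neg_len s w : S s -> ~ pos s w -> (len (s * w) < len w)%N.
Proof.
move=> Ss; have [l [Sl _] [-> <-]] := len_word genW invS w => np.
have p1 := pos1 Ss.
have [|l' [Sl' -> ]] := exchange (@subset_refl _ S) Ss Sl p1; first by rewrite mul1g.
by rewrite !mul1g => ->; apply: len_le.
Qed.

Lemma posC s w : S s -> pos s (s * w) <-> ~ pos s w.
Proof.
move=> Ss; case: sys => _ _ _ posN _; split=> [p /posN /(_ p)|n]; first exact.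
apply: contrapT => n'; have := neg_len Ss n'; rewrite (involK invS) // => l1.
by have := ltn_trans l1 (neg_len Ss n); rewrite ltnn.
Qed.

Lemma pos_len s w : S s -> pos s w -> (len w < len (s * w))%N.
Proof.
move=> Ss p; rewrite -[X in len X < _](involK invS _ Ss).
by apply: neg_len => //; apply/posC; rewrite // (involK invS).
Qed.

Definition reflection t : Prop := exists2 s, S s & exists y, t = y * s * y^-1.

Lemma reflection_gen s : S s -> reflection s.
Proof. by move=> Ss; exists s => //; exists 1; gsimp. Qed.

Lemma reflectionJ t y : reflection t -> reflection (y * t * y^-1).
Proof. by case=> s Ss [z ->]; exists s => //; exists (y * z); gsimp. Qed.

Lemma reflectionK t w : reflection t -> t * (t * w) = w.
Proof.
by case=> s Ss [y ->]; gsimp; rewrite -(mulgA y s s) invS //; gsimp.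
Qed.

(** Bruhat covers, without the requirement that lengths differ by one. *)
Definition bruhat_step z w : Prop :=
  (len z < len w)%N /\ exists2 t, reflection t & w = t * z.

(** The edge z -- z a crosses the wall of t only if t z = z a.  Otherwise z a is,
    like z, on the side of 1, and reflecting it to the other side lengthens it. *)
Lemma bruhat_step_mulr z w a : S a -> bruhat_step z w ->
  z * a = w \/ bruhat_step (z * a) (w * a).
Proof.
move=> Sa [lz [t Tt wE]]; case: (Tt) => s Ss [y tE].
pose f x := pos s (y^-1 * x).
have ft x : f (t * x) <-> ~ f x.
  by rewrite -posC // /f tE; gsimp.
have side x : ~ (f 1 <-> f x) -> (len (t * x) < len x)%N.
  have [l [Sl _] [-> <-]] := len_word genW invS x; move=> nE.
  have := @cross_gallery S y s 1 l (@subset_refl _ S) Ss Sl.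
  rewrite !mul1g => /(_ nE) [l' [Sl' ->]].
  by rewrite -tE mul1g => ->; apply: len_le.
have f1z : f 1 <-> f z.
  by apply: contrapT => /side; rewrite -wE ltnNge ltnW.
have [E|/(cross_edge Ss Sa)] := pselect (f z <-> f (z * a)); last first.
  by rewrite -tE -wE => ->; left.
right; split; last by exists t => //; rewrite wE mulgA.
have -> : z * a = t * (w * a) by rewrite wE -mulgA (reflectionK _ Tt).
by apply: side; rewrite wE -mulgA ft f1z E; tauto.
Qed.

Lemma bruhat_stepV z w : bruhat_step z w -> bruhat_step z^-1 w^-1.
Proof.
move=> [lz [t Tt wE]]; split; first by rewrite !(lenV genW invS).
exists (z^-1 * t * z); first by have := reflectionJ z^-1 Tt; gsimp.
have tV : t^-1 = t by apply: mulg1_eq; have := reflectionK 1 Tt; gsimp.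
by rewrite wE invgM tV; gsimp.
Qed.

Lemma bruhat_step_mull z w s : S s -> bruhat_step z w ->
  s * z = w \/ bruhat_step (s * z) (s * w).
Proof.
move=> Ss /bruhat_stepV /(bruhat_step_mulr Ss).
have sV := invol_inv invS Ss.
case=> [e|/bruhat_stepV]; last by rewrite !invgM !invgK sV; right.
by left; rewrite -[w]invgK -e invgM sV invgK.
Qed.

Inductive bruhat z : W -> Prop :=
| bruhat_refl : bruhat z z
| bruhat_extend w x : bruhat z w -> bruhat_step w x -> bruhat z x.

Lemma bruhat_len z w : bruhat z w -> (len z <= len w)%N.
Proof. by elim=> // x y _ lx [ly _]; apply: leq_trans lx (ltnW ly). Qed.

Lemma bruhat_lift_left z w s : S s -> bruhat z w ->
  bruhat (s * z) w \/ bruhat (s * z) (s * w).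
Proof.
move=> Ss; elim=> [|x y _ IH xy]; first by right; exact: bruhat_refl.
case: IH => [le|le]; first by left; apply: bruhat_extend le xy.
case: (bruhat_step_mull Ss xy) => [<-|sxy]; first by left.
by right; apply: bruhat_extend le sxy.
Qed.

Lemma bruhat_lift_right z w a : S a -> bruhat z w ->
  bruhat z (w * a) \/ bruhat (z * a) (w * a).
Proof.
move=> Sa; elim=> [|x y zx IH xy]; first by right; exact: bruhat_refl.
case: (bruhat_step_mulr Sa xy) => [<-|sxy].
  by left; rewrite -mulgA invS // mulg1.
by case: IH => le; [left|right]; apply: bruhat_extend le sxy.
Qed.

Lemma bruhat1 w : bruhat 1 w.
Proof.
have [n] := ubnP (len w); elim: n w => // n IH w.
have [->|/eqP] := eqVneq w 1; first by move=> _; exact: bruhat_refl.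
move=> /(exists_left_descent genW invS) [s [u [Ss wE lw]]].
rewrite lw ltnS => lu; apply: bruhat_extend (IH u lu) _.
by split; [rewrite lw | exists s => //; exact: reflection_gen].
Qed.

(** * Shortest coset representatives *)

Definition shortest_left J v : Prop := forall a, gen J a -> (len v <= len (a * v))%N.
Definition shortest_right J v : Prop := forall a, gen J a -> (len v <= len (v * a))%N.

Lemma shortest_left1 J : shortest_left J 1.
Proof. by move=> a _; rewrite (len1 genW invS). Qed.

Lemma shortest_rightV J v : shortest_right J v -> shortest_left J v^-1.
Proof.
move=> mv a Ja; rewrite (lenV genW invS) -(lenV genW invS (a * _)) invgM invgK.
exact: mv (subgroup_V (gen_subgroup J) Ja).
Qed.

Lemma exists_shortest (P : W -> Prop) x : P x ->
  exists2 v, P v & forall y, P y -> (len v <= len y)%N.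
Proof.
move=> Px; have exP : exists n, `[< exists2 v, P v & len v = n >].
  by exists (len x); apply/asboolP; exists x.
case: (ex_minnP exP) => n /asboolP [v Pv <-] min.
by exists v => // y Py; apply: min; apply/asboolP; exists y.
Qed.

Lemma exists_shortest_left J x : exists2 a, gen J a & shortest_left J (a * x).
Proof.
have sJ := gen_subgroup J.
have [|_ [a Ja <-] min] := @exists_shortest [set a * x | a in gen J] x.
  by exists 1; rewrite ?mul1g //; apply: subgroup_1 sJ.
exists a => // b Jb; apply: min; exists (b * a); last by gsimp.
exact: subgroup_M sJ Jb Ja.
Qed.

Lemma exists_shortest_double I J x : exists a b,
  [/\ gen I a, gen J b, shortest_left I (a * x * b) &
      shortest_right J (a * x * b)].
Proof.
have sI := gen_subgroup I; have sJ := gen_subgroup J.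
have [|_ [a Ia [b Jb <-]] min] :=
    @exists_shortest [set a * x * b | a in gen I & b in gen J] x.
  by exists 1; [exact: subgroup_1 sI|exists 1; [exact: subgroup_1 sJ|gsimp]].
exists a, b; split=> // [c Ic|c Jc]; apply: min.
  by exists (c * a); [exact: subgroup_M sI Ic Ia|exists b => //; gsimp].
by exists a => //; exists (b * c); [exact: subgroup_M sJ Jb Jc|gsimp].
Qed.

(** If the length failed to add up, the exchange condition would delete a
    letter either from the minimal word l or from v, and the latter would give
    a shorter element in the coset of v. *)
Lemma minword_shortest_len J l v : J `<=` S -> minword J l -> shortest_left J v ->
  len (wprod l * v) = (size l + len v)%N.
Proof.
move=> JS ml sv; elim: l ml => [|s l IH] ml; first by rewrite wprod_nil mul1g.
have ml' := minword_behead ml; have {}IH := IH ml'.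
have [/= /andP [/set_mem Js Jl] min] := ml; have Ss := JS _ Js.
have SJ := sub_all (fun x (xJ : x \in J) => mem_set (JS _ (set_mem xJ))).
rewrite wprod_cons -mulgA; apply/eqP; rewrite eqn_leq; apply/andP; split.
  by apply: leq_trans (len_mull genW invS _ Ss) _; rewrite IH.
rewrite /= addSn -IH; apply: (pos_len Ss); apply: contrapT.
have [p|np] := pselect (pos s (wprod l)); last first.
  have p1 := pos1 Ss.
  move=> _; have [|l' [Jl' lE e]] := exchange JS Ss Jl p1; first by rewrite mul1g.
  have : ((size l).+1 <= size l')%N.
    by apply: min => //; rewrite wprod_cons; move: e; rewrite !mul1g.
  by rewrite lE ltnNge leqnSn.
have [lv [Sv _] [vE lvE]] := len_word genW invS v.
rewrite vE => /(exchange (@subset_refl _ S) Ss Sv p) [lv' [Sv' lE e]].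
have v'E : wprod lv' = (wprod l)^-1 * s * wprod l * v.
  by rewrite -[LHS](mulKg (wprod l)) -e -vE; gsimp.
have Jc : gen J ((wprod l)^-1 * s * wprod l).
  have sJ := gen_subgroup J; have Jw := wprod_gen Jl.
  exact: (subgroup_M sJ (subgroup_M sJ (subgroup_V sJ Jw) (subset_gen Js)) Jw).
have := sv _ Jc; rewrite -v'E -lvE lE ltnNge len_le //.
Qed.

Lemma minword_reduced J l : J `<=` S -> minword J l -> len (wprod l) = size l.
Proof.
move=> JS ml; have := minword_shortest_len JS ml (shortest_left1 (J := J)).
by rewrite mulg1 (len1 genW invS) addn0.
Qed.

Lemma shortest_left_len J a v : J `<=` S -> gen J a -> shortest_left J v ->
  len (a * v) = (len a + len v)%N.
Proof.
move=> JS /(minwordP invS JS) [l ml ->] sv.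
by rewrite (minword_shortest_len JS) // (minword_reduced JS).
Qed.

Lemma shortest_right_len J a v : J `<=` S -> gen J a -> shortest_right J v ->
  len (v * a) = (len v + len a)%N.
Proof.
move=> JS Ja /shortest_rightV sv; rewrite -(lenV genW invS) invgM.
have := shortest_left_len JS (subgroup_V (gen_subgroup J) Ja) sv.
by rewrite !(lenV genW invS) addnC.
Qed.

Lemma gen_len_le1 J c : J `<=` S -> gen J c -> c <> 1 -> (len c <= 1)%N -> J c.
Proof.
move=> JS /(minwordP invS JS) [l ml ->]; rewrite (minword_reduced JS) //.
case: l ml => [|s [|? ?]] //; first by rewrite wprod_nil.
by move=> [/= /andP [/set_mem Js _] _]; rewrite wprod1.
Qed.

Lemma gen_left_descent J a : J `<=` S -> gen J a -> a <> 1 ->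
  exists s b, [/\ J s, gen J b, a = s * b & len a = (len b).+1].
Proof.
move=> JS /(minwordP invS JS) [[|s l] ml ->]; first by rewrite wprod_nil.
have [/andP [/set_mem Js Jl] _] := ml => _; have ml' := minword_behead ml.
exists s, (wprod l); split; rewrite -?wprod_cons //; first exact: wprod_gen.
by rewrite !(minword_reduced JS).
Qed.

(** Kilmoyer's description of W_I meet x W_J x^-1 for x shortest in W_I x W_J:
    if a = i a' is reduced, deleting a letter from x b = a x to get a' x can
    only happen within b, so that x^-1 i x lies in W_J and has length one. *)
Lemma gen_cap_conj I J x a : I `<=` S -> J `<=` S ->
  shortest_left I x -> shortest_right J x ->
  gen I a -> gen J (x^-1 * a * x) ->
  gen [set i | I i /\ J (x^-1 * i * x)] a.
Proof.
move=> IS JS lx rx; set K := [set i | _]; have sJ := gen_subgroup J.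
have [n] := ubnP (len a); elim: n a => // n IH a lean Ia Jb.
have [->|/eqP a1] := eqVneq a 1; first exact: subgroup_1 (gen_subgroup K).
have [i [a' [Ii Ia' aE lea]]] := gen_left_descent IS Ia a1.
have Si := IS _ Ii; have ii := involK invS _ Si.
have [l Jl bE] := (gen_wordP invS _ JS).1 Jb.
have axE : a * x = x * wprod l by rewrite -bE; gsimp.
have pix : pos i x.
  apply: contrapT => /(neg_len Si); rewrite ltnNge lx //; exact: subset_gen.
have npix : ~ pos i (x * wprod l).
  rewrite -axE; move=> /(pos_len Si).
  have -> : i * (a * x) = a' * x by rewrite aE -mulgA ii.
  rewrite !(shortest_left_len IS) // lea.
  by rewrite addSn ltnNge leqnSn.
have [l' [Jl' _ e]] := exchange JS Si Jl pix npix.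
have cE : x^-1 * i * x = wprod l' * (wprod l)^-1.
  by rewrite -[LHS](mulgK (wprod l)) -!(mulgA x^-1) -(mulgA i) e; gsimp.
have Jc : gen J (x^-1 * i * x).
  by rewrite cE; apply: (subgroup_M sJ (wprod_gen Jl') (subgroup_V sJ (wprod_gen Jl))).
have Ji : J (x^-1 * i * x).
  apply: gen_len_le1 => //.
    move=> /(congr1 (fun y => x * y * x^-1)); gsimp; exact: gen_neq1.
  rewrite -(leq_add2l (len x)) -(shortest_right_len JS Jc rx); gsimp.
  by rewrite addn1; apply: len_mull.
have sK := gen_subgroup K.
rewrite aE; apply: (subgroup_M sK); first exact: subset_gen.
apply: IH => //; first by rewrite -ltnS -lea.
have -> : x^-1 * a' * x = (x^-1 * i * x)^-1 * (x^-1 * a * x) by rewrite aE; gsimp.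
exact: subgroup_M sJ (subgroup_V sJ Jc) Jb.
Qed.

Lemma gen_cap I J a : I `<=` S -> J `<=` S -> gen I a -> gen J a -> gen (I `&` J) a.
Proof.
move=> IS JS Ia Ja.
have sr1 : shortest_right J 1 by move=> b _; rewrite (len1 genW invS).
have := @gen_cap_conj I J 1 a IS JS (@shortest_left1 I) sr1 Ia; gsimp=> /(_ Ja).
by apply: genS => i [Ii]; gsimp.
Qed.

(** * Commensurability of parabolic subgroups of a Coxeter group *)

Section FiniteRank.
Hypothesis finS : finite_set S.

(** The elements below u in the Bruhat order form a finite set, which meets
    every coset x W_I with x in W_L: by the lifting properties, the union of
    the cosets it meets is stable under left multiplication by L. *)
Lemma coset_finite_folded I L u : I `<=` S -> L `<=` S ->
  (forall t, L t -> (len (t * u) < len u)%N \/ exists2 i, I i & t * u = u * i) ->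
  coset_finite (gen L) 1 (gen I).
Proof.
move=> IS LS folded; have sI := gen_subgroup I.
have below x : gen L x -> exists z a, [/\ bruhat z u, gen I a & x = z * a].
  move=> /(gen_wordP invS _ LS) [l Ll ->].
  elim: l Ll => [_|t l IH /= /andP [/set_mem Lt /IH [z [a [zu Ia e]]]]].
    exists 1, 1; rewrite wprod_nil mulg1; split=> //; first exact: bruhat1.
    exact: subgroup_1 sI.
  have St := LS _ Lt; rewrite wprod_cons {}e.
  have tu : bruhat (t * z) u \/
      exists2 i, I i & bruhat (t * z) u \/ bruhat (t * z * i) u.
    have [dec|[i Ii e]] := folded t Lt.
      left; have [//|le] := bruhat_lift_left St zu.
      apply: bruhat_extend le _; split=> //.
      by exists t; [exact: reflection_gen | rewrite (involK invS)].
    have [le|le] := bruhat_lift_left St zu; first by left.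
    right; exists i => //; rewrite e in le; have Si := IS _ Ii.
    by have := bruhat_lift_right Si le; rewrite -(mulgA u) invS // mulg1.
  case: tu => [le|[i Ii [le|le]]]; first by exists (t * z), a; rewrite mulgA.
    by exists (t * z), a; rewrite mulgA.
  exists (t * z * i), (i * a); split=> //.
    exact: subgroup_M sI (subset_gen Ii) Ia.
  by rewrite -!mulgA (involK invS) //; apply: IS.
have ball := finite_ball genW invS (len u) finS.
apply: (sub_finite_set _ (finite_image (fun z => lcoset z (gen I)) ball)).
move=> _ [x Lx <-]; have [z [a [zu Ia ->]]] := below x Lx.
exists z; first exact: bruhat_len.
by apply/lcoset_eqP => //; gsimp.
Qed.

(** In Coxeter terms: no irreducible component of I is spherical. *)
Definition tight I : Prop :=
  forall I0, I0 `<=` I -> coset_finite (gen I) 1 (gen I0) -> I `<=` I0.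

Lemma exists_tight J : J `<=` S ->
  exists I, [/\ I `<=` J, coset_finite (gen J) 1 (gen I) & tight I].
Proof.
move=> JS; have [l ->] := (finite_seqP J).1 (sub_finite_set JS finS).
have [n] := ubnP (size l); elim: n l => // n IH l ln.
have [tl|] := pselect (tight [set` l]).
  by exists [set` l]; split=> //; apply: coset_finite1 => //; apply: gen_subgroup.
move=> /existsNP [I0 /not_implyP [I0l /not_implyP [f0]]].
move=> /existsNP [x /not_implyP [xl I0x]].
pose l0 := [seq y <- l | y \in I0].
have l0E : [set` l0] = I0.
  apply/seteqP; split=> y; rewrite /= mem_filter; first by case/andP => /set_mem.
  by move=> I0y; rewrite (I0l _ I0y) andbT; apply/mem_set.
have [|I [Il0 f tI]] := IH l0.
  move: ln; rewrite ltnS; apply: leq_trans; rewrite size_filter.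
  have := count_predC (fun y => y \in I0) l.
  have : (0 < count (predC (fun y => y \in I0)) l)%N.
    by rewrite -has_count; apply/hasP; exists x => //=; apply/negP => /set_mem.
  by move=> pos0 <-; rewrite -addn1 leq_add2l.
exists I; rewrite l0E in Il0 f; split=> //; first exact: subset_trans Il0 I0l.
rewrite -(mulg1 1); apply: coset_finite_trans f0 f; exact: gen_subgroup.
Qed.

(** Rigidity of tight subsets.  Peel from x a nontrivial factor u in W_L, where
    L adds to I one left descent s of x.  Comparing lengths, u conjugates I
    into L, missing exactly one element r; then r shortens u^-1 while the rest
    of L permutes cosets as I does, so that W_I and its conjugate both have
    finite index in W_L.  As I is tight, the conjugate is W_I again. *)
Lemma tight_conjugate I x : I `<=` S -> tight I -> shortest_left I x ->
  conjugate x^-1 I `<=` S -> conjugate x^-1 I = I.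
Proof.
move=> IS tI; have [n] := ubnP (len x); elim: n x => // n IH x lx sx xIS.
have [->|/eqP x1] := eqVneq x 1; first by rewrite invg1 conjugate1.
have sI := gen_subgroup I.
have [s [x0 [Ss xE lxE]]] := exists_left_descent genW invS x1.
have sxx0 : s * x = x0 by rewrite xE (involK invS).
have Is : ~ I s.
  by move=> /subset_gen /sx; rewrite sxx0 lxE ltnn.
pose L := s |` I.
have LS : L `<=` S by move=> y [->|/IS].
have IL : I `<=` L by move=> i Ii; right.
have sL := gen_subgroup L.
have [u [v [Lu sv xuv]]] : exists u v, [/\ gen L u, shortest_left L v & x = u * v].
  have [a La sv] := exists_shortest_left L x.
  exists a^-1, (a * x); split=> //; last by gsimp.
  exact: subgroup_V sL La.
have len_uv b : gen L b -> len (b * u * v) = (len (b * u) + len v)%N.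
  by move=> Lb; apply: (shortest_left_len LS _ sv); apply: subgroup_M sL Lb Lu.
have lxuv : len x = (len u + len v)%N.
  by have := len_uv 1 (subgroup_1 sL); rewrite mul1g -xuv.
have u1 : u <> 1.
  move=> u1; have := sv s (subset_gen (or_introl erefl : L s)).
  by rewrite -[v]mul1g -u1 -xuv sxx0 lxE ltnn.
pose I1 := conjugate u^-1 I.
have xI1 : conjugate v^-1 I1 = conjugate x^-1 I by rewrite conjugateM -invgM -xuv.
(* t v = v i' with i' in S, and lengths add up on the left, so len t <= 1. *)
have I1L : I1 `<=` L.
  move=> _ [i Ii <-]; rewrite invgK; set t := u^-1 * i * u.
  have Lt : gen L t.
    exact: (subgroup_M sL (subgroup_M sL (subgroup_V sL Lu) (subset_gen (IL _ Ii))) Lu).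
  apply: gen_len_le1 => //.
    move=> /(congr1 (fun y => u * y * u^-1)); rewrite /t; gsimp.
    exact: gen_neq1 (IS _ Ii).
  have Si' : S (x^-1 * i * x) by apply: xIS; apply/conjugateE; gsimp.
  rewrite -(leq_add2r (len v)) -(shortest_left_len LS Lt sv).
  have -> : t * v = v * (x^-1 * i * x) by rewrite /t xuv; gsimp.
  by rewrite add1n; apply: len_mulr.
have su : shortest_left I u.
  move=> b Ib; have Lb := genS IL Ib.
  by have := sx b Ib; rewrite {2}xuv mulgA len_uv // lxuv leq_add2r.
have injJ : injective (fun y => u^-1 * y * u^-1^-1) by move=> y z /mulIg /mulgI.
have [r I1r LE] := finite_image_exchange (sub_finite_set IS finS) injJ Is I1L.
have lenu : len u^-1 = len u := lenV genW invS u.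
have I1u t : I1 t -> exists2 i, I i & t * u^-1 = u^-1 * i.
  by case=> i Ii <-; exists i => //; gsimp.
have finL : coset_finite (gen L) 1 (gen I).
  apply: (@coset_finite_folded _ _ u^-1) => // t.
  rewrite /L LE => -[->|/I1u]; last by right.
  (* u^-1 has a left descent in L, and it cannot be in I1 since u is shortest. *)
  left; have [|t0 [b [Lt0 Lb uE leu]]] := gen_left_descent LS (subgroup_V sL Lu).
    by move=> /(congr1 (fun y => y^-1)); rewrite invgK invg1.
  have bE : t0 * u^-1 = b by rewrite uE (involK invS) //; apply: LS.
  have [e|/I1u [i Ii e]] : (t0 = r) \/ I1 t0 by move: Lt0; rewrite /L LE.
    by rewrite -e bE leu.
  have iuE : i * u = b^-1.
    by rewrite -bE e invgM invgK (invol_inv invS) //; apply: IS.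
  have := su i (subset_gen Ii).
  by rewrite iuE (lenV genW invS) -lenu leu ltnn.
have finI1 : coset_finite (gen I) 1 (gen I1).
  have f : coset_finite (gen L) (1 * u) (gen I1).
    apply: coset_finite_trans finL _; [exact: sI|exact: gen_subgroup|].
    apply: coset_finite_sub; first exact: gen_subgroup.
    by move=> h /(@gen_conjugate _ u^-1); rewrite invgK.
  (* u belongs to W_L, so that W_L u W_I1 = W_L W_I1. *)
  have {}f : coset_finite (gen L) 1 (gen I1).
    have sI1 := gen_subgroup I1.
    apply/(coset_finite_shift 1 sL sI1 Lu (subgroup_1 sI1)).
    by move: f; gsimp.
  rewrite -(mulg1 1); apply: (coset_finite_trans sL (gen_subgroup I1) _ f).
  by apply: coset_finite1 => //; apply: genS.
have II1 : I `<=` I1.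
  have cap : coset_finite (gen I) 1 (gen (I `&` I1)).
    apply: (coset_finite_cap _ _ _ _ finI1); try exact: gen_subgroup.
    move=> h Ih; gsimp; apply: gen_cap => //; exact: subset_trans I1L LS.
  by move=> i /(tI _ (@subIsetl _ _ _) cap) [].
have I1E : I1 = I by apply: finite_image_sub_eq (sub_finite_set IS finS) II1.
rewrite -xI1 I1E; apply: IH.
- rewrite -ltnS; apply: leq_trans lx; rewrite ltnS lxuv -add1n leq_add2r lt0n.
  by apply/eqP => /(len_eq0 genW invS).
- by move=> b /(genS IL); apply: sv.
- by rewrite -I1E xI1.
Qed.

(** For I tight of finite index in J, Kilmoyer's theorem turns the hypothesis
    into an inclusion of a conjugate of I in J', and rigidity says that the
    conjugate is I itself. *)
Lemma coset_finite_parabolic J J' w : J `<=` S -> J' `<=` S ->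
  coset_finite (gen J) w (gen J') ->
  exists I a b, [/\ I `<=` J /\ I `<=` J', coset_finite (gen J) 1 (gen I),
    gen J a, gen J' b & conjugate (a * w * b)^-1 I = I].
Proof.
move=> JS J'S fw; have [I [IJ fI tI]] := exists_tight JS.
have IS := subset_trans IJ JS.
have sI := gen_subgroup I; have sJ := gen_subgroup J; have sJ' := gen_subgroup J'.
have [a [b [Ia Jb]]] := exists_shortest_double I J' w.
set x := a * w * b => lx rx.
have fx : coset_finite (gen I) x (gen J').
  apply/coset_finite_shift => //; rewrite -(mul1g w).
  by apply: coset_finite_trans fw => //; apply: coset_finite1 => //; apply: genS.
have IxJ' : I `<=` [set i | I i /\ J' (x^-1 * i * x)].
  apply: tI; first by move=> i [].
  apply: (coset_finite_cap _ _ _ _ fx) => //; first exact: gen_subgroup.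
  by move=> h; apply: gen_cap_conj.
have xIJ' : conjugate x^-1 I `<=` J'.
  by move=> _ [i /IxJ' [_ J'i] <-]; rewrite invgK.
have xI := tight_conjugate IS tI lx (subset_trans xIJ' J'S).
exists I, a, b; split=> //; last by apply: genS Ia.
by split=> //; rewrite -xI.
Qed.

End FiniteRank.
End Folding.
Arguments shortest_left {W} S J v.

(** * The Bruhat decomposition of a group with a BN-pair *)

Section BruhatDecomposition.
Local Open Scope group_scope.
Context {G : groupType} {B N : set G} {nT : normal (B `&` N) N}.
Local Notation W := (quotient nT).
Implicit Types (J : set W) (s u v w : W) (b n x y g : G).
Local Notation "n 'lifts' w" := (quotient_set w n) (at level 70).
Local Notation dc := (@double_coset _ _ _ nT).

Lemma quotient_ex w : exists n, n lifts w.
Proof.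
case: w => X XN; case: (set_mem XN) => n Nn XE; exists n => /=.
by rewrite -XE; exists 1; rewrite ?mulg1 //; apply: subgroup_1; case: nT.
Qed.

Lemma quotient_of n : N n -> exists w : W, n lifts w.
Proof.
move=> Nn; have XN : lcoset n (B `&` N) \in @lcosets _ (B `&` N) N.
  by apply/mem_set; exists n.
exists (Defs.Quotient nT XN) => /=; exists 1; rewrite ?mulg1 //.
by apply: subgroup_1; case: nT.
Qed.

Lemma quotient_lcoset w n : n lifts w -> quotient_set w = lcoset n (B `&` N).
Proof.
case: w => X XN; case: (set_mem XN) => m Nm XE /=; rewrite -XE => -[t Tt <-].
by apply/lcoset_eqP; [case: nT | gsimp].
Qed.

Lemma quotient_sub w n : n lifts w -> N n.
Proof.
case: w => X XN; case: (set_mem XN) => m Nm XE /=; rewrite -XE => -[t [_ Nt] <-].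
by apply: subgroup_M => //; case: nT.
Qed.

Lemma quotient_inj w w' n : n lifts w -> n lifts w' -> w = w'.
Proof.
by move=> /quotient_lcoset wE /quotient_lcoset w'E; apply: val_inj; rewrite /= wE w'E.
Qed.

Lemma quotientM u v n m : n lifts u -> m lifts v -> n * m lifts u * v.
Proof. by move=> un vm; exists n => //; exists m. Qed.

Lemma quotientV u n : n lifts u -> n^-1 lifts u^-1.
Proof. by move=> un; exists n. Qed.

Context {S : set W}.
Hypothesis bn : bn_pair S.

Let sB : subgroup B. Proof. by case: bn. Qed.
Let genW : gen S = setT. Proof. by case: bn. Qed.
Let invS s : S s -> s * s = 1. Proof. by case: bn => _ _ _ [+ _ _]; apply. Qed.
Local Notation len := (len S).

Lemma dcP w n x : n lifts w ->
  dc w x <-> exists b b', [/\ B b, B b' & x = b * n * b'].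
Proof.
move=> wn; split=> [[b Bb [_ [m wm [b' Bb' <-]] <-]]|[b [b' [Bb Bb' ->]]]].
  move: wm; rewrite (quotient_lcoset wn) => -[t [Bt _] <-].
  by exists b, (t * b'); split=> //; [apply: subgroup_M | gsimp].
by exists b => //; exists (n * b'); [exists n => //; exists b' | gsimp].
Qed.

Lemma dc_rep w n : n lifts w -> dc w n.
Proof.
by move=> wn; apply/(dcP _ wn); exists 1, 1; split; gsimp => //; apply: subgroup_1.
Qed.

Lemma dc_mul w b x b' : B b -> B b' -> dc w x -> dc w (b * x * b').
Proof.
move=> Bb Bb'; have [n wn] := quotient_ex w.
move=> /(dcP _ wn) [c [c' [Bc Bc' ->]]]; apply/(dcP _ wn).
by exists (b * c), (c' * b'); split; [apply: subgroup_M|apply: subgroup_M|gsimp].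
Qed.

Lemma dcV w x : dc w x -> dc w^-1 x^-1.
Proof.
have [n wn] := quotient_ex w; move=> /(dcP _ wn) [b [b' [Bb Bb' ->]]].
apply/(dcP _ (quotientV wn)); exists b'^-1, b^-1.
by split; [apply: subgroup_V|apply: subgroup_V|gsimp].
Qed.

Lemma dc1P x : dc 1 x <-> B x.
Proof.
have w1 : 1 lifts (1 : W) by apply: subgroup_1; case: nT.
rewrite (dcP _ w1); split=> [[b [b' [Bb Bb' ->]]]|Bx].
  by gsimp; apply: subgroup_M.
by exists 1, x; split=> //; [apply: subgroup_1 | gsimp].
Qed.

Lemma dc_split u v x : dc (u * v) x -> exists x1 x2,
  [/\ dc u x1, dc v x2 & x = x1 * x2].
Proof.
have [n un] := quotient_ex u; have [m vm] := quotient_ex v.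
move=> /(dcP _ (quotientM un vm)) [b [b' [Bb Bb' ->]]].
exists (b * n), (m * b'); split; last by gsimp.
  by rewrite -(mulg1 (b * n)); apply: dc_mul (dc_rep un) => //; apply: subgroup_1.
by rewrite -(mul1g m); apply: dc_mul (dc_rep vm) => //; apply: subgroup_1.
Qed.

Lemma dc_mulr w s x y : S s -> dc w x -> dc s y ->
  dc w (x * y) \/ dc (w * s) (x * y).
Proof.
case: bn => _ _ _ [_ ax _] Ss wx sy.
by apply: (ax w s Ss); exists x => //; exists y.
Qed.

Lemma dc_mull w s x y : S s -> dc s x -> dc w y ->
  dc w (x * y) \/ dc (s * w) (x * y).
Proof.
move=> Ss /dcV; rewrite (invol_inv invS Ss) => sx /dcV wy.
have [] := dc_mulr Ss wy sx => /dcV; gsimp; first by left.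
by rewrite (invol_inv invS Ss); right.
Qed.

(** Disjointness of the double cosets, by induction on the shorter of the two
    elements: after stripping a letter s from it, the product rule leaves only
    two candidates for the other. *)
Lemma dc_inj w w' x : dc w x -> dc w' x -> w = w'.
Proof.
suff main v v' y : (len v <= len v')%N -> dc v y -> dc v' y -> v = v'.
  move=> wx w'x; case: (leqP (len w) (len w')) => [le|/ltnW le].
    exact: main le wx w'x.
  by rewrite (main _ _ _ le w'x wx).
move: v v' y {x} => {}w {}w' x; have [n] := ubnP (len w).
elim: n w w' x => // n IH w w' x ln le.
have [->|/eqP w1] := eqVneq w 1.
  move=> /dc1P Bx; have [m w'm] := quotient_ex w'.
  move=> /(dcP _ w'm) [b [b' [Bb Bb' xE]]].
  apply: (quotient_inj _ w'm); split; last exact: quotient_sub w'm.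
  have -> : m = b^-1 * x * b'^-1 by rewrite xE; gsimp.
  exact: (subgroup_M sB (subgroup_M sB (subgroup_V sB Bb) Bx) (subgroup_V sB Bb')).
have [s [u [Ss wE lw]]] := exists_left_descent genW invS w1.
rewrite {1}wE => /dc_split [x1 [x2 [sx1 ux2 xE]]] w'x.
have sx1V : dc s x1^-1 by have := dcV sx1; rewrite (invol_inv invS Ss).
have x2E : x1^-1 * x = x2 by rewrite xE; gsimp.
have lu : (len u < n)%N by rewrite -ltnS -lw.
have luw' : (len u < len w')%N by rewrite -lw.
have := dc_mull Ss sx1V w'x; rewrite x2E => -[w'x2|sw'x2].
  suff uw' : u = w' by move: luw'; rewrite uw' ltnn.
  exact: IH lu (ltnW luw') ux2 w'x2.
rewrite wE (IH _ _ _ lu _ ux2 sw'x2) ?(involK invS) //.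
rewrite -ltnS; apply: leq_trans luw' _.
by have := len_mull genW invS (s * w') Ss; rewrite (involK invS).
Qed.

(** The half-space of s, read off from the product rule: it consists of the w
    for which the product of the double cosets of s and w is that of s w alone. *)
Definition bn_pos s w : Prop := forall x y, dc s x -> dc w y -> ~ dc w (x * y).

Lemma bn_pos_mul s w x y : S s -> bn_pos s w -> dc s x -> dc w y -> dc (s * w) (x * y).
Proof. by move=> Ss p sx wy; case: (dc_mull Ss sx wy) => // /(p _ _ sx wy). Qed.

Lemma bn_gen_not_sub s : S s ->
  exists n m b, [/\ n lifts s, m lifts s, B b & ~ B (n * b * m)].
Proof.
move=> Ss; case: bn => _ _ _ [_ _ /(_ s Ss) /existsNP [x /not_implyP [sBs nBx]]].
move: sBs; rewrite (invol_inv invS Ss) => -[_ [n sn [b Bb <-]] [m sm xE]].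
by exists n, m, b; rewrite xE.
Qed.

Lemma bn_pos1 s : S s -> bn_pos s 1.
Proof.
move=> Ss x y sx /dc1P By /dc1P Bxy.
have Bx : B x by have := subgroup_M sB Bxy (subgroup_V sB By); gsimp.
have s1 : s = 1 by apply: dc_inj sx _; apply/dc1P.
have [n [m [b [sn sm Bb]]]] := bn_gen_not_sub Ss; apply.
move: sn sm; rewrite s1 => -[Bn _] [Bm _].
exact: (subgroup_M sB (subgroup_M sB Bn Bb) Bm).
Qed.

(** Were w and s w both positive, multiplying the double coset of w twice by
    that of s would only give back the one of w.  But as s B s^-1 is not in B,
    the double coset of s has products n b m of two of its elements in itself,
    and these move the double coset of w to that of s w. *)
Lemma bn_posN s w : S s -> bn_pos s w -> ~ bn_pos s (s * w).
Proof.
move=> Ss p p'; have [n [m [b [sn sm Bb nB]]]] := bn_gen_not_sub Ss.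
have B1 := subgroup_1 sB; have [y wy] := quotient_ex w.
have snb : dc s (n * b) by rewrite -(mul1g n); apply: dc_mul (dc_rep sn).
have snbm : dc s (n * b * m).
  by have [|] := dc_mulr Ss snb (dc_rep sm); rewrite ?invS // => /dc1P.
have wdy := dc_rep wy.
apply: (p' _ _ snb (bn_pos_mul Ss p (dc_rep sm) wdy)).
by rewrite mulgA; apply: bn_pos_mul.
Qed.

Lemma bn_fold s s' w : S s -> S s' -> bn_pos s w -> ~ bn_pos s (w * s') ->
  s * w = w * s'.
Proof.
move=> Ss Ss' p /existsNP [x /existsNP [y]].
move=> /not_implyP [sx /not_implyP [wsy /contrapT wsxy]].
have [y1 [y2 [wy1 s'y2 yE]]] := dc_split wsy.
have s'y2V : dc s' y2^-1 by have := dcV s'y2; rewrite (invol_inv invS Ss').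
have xy1E : x * y * y2^-1 = x * y1 by rewrite yE; gsimp.
have := dc_mulr Ss' wsxy s'y2V; rewrite xy1E -mulgA invS // mulg1.
case=> [wsxy1|/(p _ _ sx wy1)//].
exact: dc_inj (bn_pos_mul Ss p sx wy1) wsxy1.
Qed.

Lemma bn_folding_system : folding_system S bn_pos.
Proof.
split=> //; [exact: bn_pos1 | exact: bn_posN | exact: bn_fold].
Qed.

Let sys := bn_folding_system.

(** * Parabolic subgroups of a group with a BN-pair *)

Lemma std_parabolic_mem J w x : gen J w -> dc w x -> std_parabolic J x.
Proof. by move=> Jw wx; exists w. Qed.

Lemma std_parabolic_gen J w x : dc w x -> std_parabolic J x -> gen J w.
Proof. by move=> wx [v Jv vx]; rewrite (dc_inj wx vx). Qed.

Lemma subset_std_parabolic J : B `<=` std_parabolic J.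
Proof.
by move=> b Bb; exists 1; [exact: subgroup_1 (gen_subgroup J) | apply/dc1P].
Qed.

Lemma subgroup_std_parabolic J : J `<=` S -> subgroup (std_parabolic J).
Proof.
move=> JS; have sJ := gen_subgroup J; apply/subgroupP; split.
  by apply: subset_std_parabolic; apply: subgroup_1.
have mulP x y : std_parabolic J x -> std_parabolic J y -> std_parabolic J (x * y).
  move=> [w /(gen_wordP invS _ JS) [l Jl ->] wx] Py.
  elim: l Jl x wx => [_|s l IH /= /andP [/set_mem Js Jl]] x.
    rewrite wprod_nil => /dc1P Bx; case: Py => v Jv vy; exists v => //.
    by rewrite -(mulg1 (x * y)); apply: dc_mul => //; apply: subgroup_1.
  rewrite wprod_cons => /dc_split [x1 [x2 [sx1 lx2 ->]]]; rewrite -mulgA.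
  have [v Jv vxy] := IH Jl x2 lx2.
  case: (dc_mull (JS _ Js) sx1 vxy) => [|svxy]; first exact: std_parabolic_mem.
  by apply: std_parabolic_mem svxy; apply: (subgroup_M sJ (subset_gen Js) Jv).
move=> x y Px [w Jw wy]; apply: mulP => //.
exact: std_parabolic_mem (subgroup_V sJ Jw) (dcV wy).
Qed.

Lemma bruhat_decomposition g : exists w, dc w g.
Proof.
suff: [set: G] `<=` std_parabolic S by move=> /(_ g I) [w _ wg]; exists w.
case: bn => _ <- _ _; apply: gen_sub; first exact: subgroup_std_parabolic.
move=> x [/(@subset_std_parabolic S) //|/quotient_of [w wx]].
by apply: std_parabolic_mem (dc_rep wx); rewrite genW.
Qed.

(** Multiplying by a letter which increases the length does not spill over into
    a second double coset. *)
Lemma dc_shortest_left J v w x n : J `<=` S -> gen J v -> shortest_left S J w ->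
  dc v x -> n lifts w -> dc (v * w) (x * n).
Proof.
move=> JS /(minwordP invS JS) [l ml ->] sw + wn.
elim: l ml x => [_ x|s l IH ml x].
  rewrite wprod_nil mul1g => /dc1P Bx.
  by rewrite -(mulg1 (x * n)); apply: dc_mul (dc_rep wn) => //; apply: subgroup_1.
have ml' := minword_behead ml; have [/andP [/set_mem Js _] _] := ml.
rewrite wprod_cons => /dc_split [x1 [x2 [sx1 lx2 ->]]].
rewrite -!mulgA; apply: (bn_pos_mul (JS _ Js)) sx1 (IH ml' _ lx2).
apply: contrapT => /(neg_len sys (JS _ Js)).
rewrite mulgA -wprod_cons (minword_shortest_len sys JS ml sw).
by rewrite (minword_shortest_len sys JS ml' sw) ltnNge leqW.
Qed.

Hypothesis commB : commensurated B.

(** The cosets of P_J' in P_J g P_J' are indexed by those of W_J' in W_J w W_J'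
    up to finite multiplicity: distinct ones stay distinct by the Bruhat
    decomposition, and when w is shortest in W_J w, each v w W_J' contributes
    the cosets of P_J' in B v w P_J', finite in number by commensuration. *)
Lemma coset_finite_std_parabolic J J' w g : J `<=` S -> J' `<=` S -> dc w g ->
  coset_finite (std_parabolic J) g (std_parabolic J') <->
  coset_finite (gen J) w (gen J').
Proof.
move=> JS J'S wg; have sJ := gen_subgroup J; have sJ' := gen_subgroup J'.
have sP := subgroup_std_parabolic JS; have sP' := subgroup_std_parabolic J'S.
have [rep repP] := choice quotient_ex.
have PB := @subset_std_parabolic J; have P'B := @subset_std_parabolic J'.
have [b [b' [/PB Pb /P'B P'b' ->]]] := (dcP g (repP w)).1 wg.
rewrite coset_finite_shift // {wg g b b' Pb P'b'}.
have P'E u v : std_parabolic J' ((rep u)^-1 * rep v) <-> gen J' (u^-1 * v).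
  have uv := dc_rep (quotientM (quotientV (repP u)) (repP v)).
  by split=> [/(std_parabolic_gen uv)|/std_parabolic_mem]; [|apply].
have mulE u v : lcoset (rep u * rep v) (std_parabolic J') =
    lcoset (rep (u * v)) (std_parabolic J').
  apply/lcoset_eqP => //; apply: std_parabolic_mem (subgroup_1 sJ') _.
  apply: dc_rep; rewrite -(mulVg (u * v)); apply: quotientM (repP _).
  exact: quotientV (quotientM (repP u) (repP v)).
split=> [fP|].
  apply: (@finite_image_factor _ _ _ (gen J)
    (fun v => lcoset (rep v * rep w) (std_parabolic J'))).
    by move=> u v _ _; rewrite !mulE !lcoset_eqP // P'E.
  apply: sub_finite_set fP => _ [v Jv <-]; exists (rep v) => //.
  exact: std_parabolic_mem Jv (dc_rep (repP v)).
have [a Ja sw] := @exists_shortest_left _ S J w.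
have Pa : std_parabolic J (rep a) := std_parabolic_mem Ja (dc_rep (repP a)).
rewrite -(coset_finite_shift w sJ sJ' Ja (subgroup_1 sJ')) mulg1.
set w0 := a * w => fW.
suff fP : coset_finite (std_parabolic J) (rep w0) (std_parabolic J').
  have P't : std_parabolic J' ((rep w0)^-1 * (rep a * rep w)).
    by apply/lcoset_eqP; rewrite // mulE.
  have /= := coset_finite_shift (rep w0) sP sP' (subgroup_V sP Pa) P't.
  by gsimp => ->.
pose E X := \bigcup_(u in X) [set lcoset (b * rep u) (std_parabolic J') | b in B].
apply: (@sub_finite_set _ _
  (\bigcup_(X in [set lcoset (v * w0) (gen J') | v in gen J]) E X)).
  move=> _ [x [v Jv vx] <-]; exists (lcoset (v * w0) (gen J')); first by exists v.
  exists (v * w0); first by exists 1; [exact: subgroup_1 sJ' | rewrite mulg1].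
  have := dc_shortest_left JS Jv sw vx (repP w0).
  move=> /(dcP _ (repP _)) [b [b' [Bb Bb' ->]]]; exists b => //.
  by apply/lcoset_eqP => //; gsimp; apply: P'B.
apply: bigcup_finite => // _ [v Jv <-].
have : coset_finite B (rep (v * w0)) (std_parabolic J').
  rewrite -(mulg1 (rep _)); apply: (@coset_finite_trans _ _ _ B) => //.
    exact: commensurated_coset_finite.
  exact: coset_finite1.
apply: sub_finite_set => _ [_ [k J'k <-] [b Bb <-]]; exists b => //.
apply/lcoset_eqP => //; gsimp; apply/P'E; gsimp.
exact: J'k.
Qed.

(** * The order on commensurability classes *)

Hypothesis finS : finite_set S.

Lemma class_of_eqE J J' : J `<=` S -> J' `<=` S ->
  class_of S (gen J) = class_of S (gen J') <->
  coset_finite (gen J) 1 (gen J') /\ coset_finite (gen J') 1 (gen J).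
Proof.
move=> JS J'S; have sJ := gen_subgroup J; have sJ' := gen_subgroup J'.
split=> [e|[f f']].
  have : class_of S (gen J') (gen J).
    rewrite -e; split; first by exists J.
    by apply/commensurableE => //; split; apply: coset_finite1.
  by case=> _ /commensurableE; apply.
apply/seteqP; split=> _ [[K KS <-] /commensurableE c]; have sK := gen_subgroup K;
  have [fK fK'] := c sK (gen_subgroup _); (split; first by exists K);
  apply/commensurableE => //; rewrite -(mulg1 1).
- split; first by apply: (coset_finite_trans sJ) fK f.
  by apply: (coset_finite_trans sJ) f' fK'.
- split; first by apply: (coset_finite_trans sJ') fK f'.
  by apply: (coset_finite_trans sJ') f fK'.
Qed.

Lemma class_leE J J' : J `<=` S -> J' `<=` S ->
  class_le (class_of S (gen J)) (class_of S (gen J')) <->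
  coset_finite (gen J) 1 (gen J').
Proof.
move=> JS J'S; have sJ := gen_subgroup J; have sJ' := gen_subgroup J'; split.
  move=> [_ [_ [[[H HS <-] cH] [[K KS <-] cK] HK]]].
  have sH := gen_subgroup H; have sK := gen_subgroup K.
  have [_ fJH] := (commensurableE sH sJ).1 cH.
  have [fKJ' _] := (commensurableE sK sJ').1 cK.
  rewrite -(mulg1 1); apply: (coset_finite_trans sH) fJH _ => //.
  rewrite -(mulg1 1); apply: (coset_finite_trans sK) fKJ' => //.
  exact: coset_finite1.
move=> /(coset_finite_parabolic bn_folding_system finS JS J'S).
move=> [I [_ [_ [[IJ IJ'] fI _ _ _]]]]; have sI := gen_subgroup I.
exists (gen I), (gen J'); split; last exact: genS.
  split; first by exists I => //; apply: subset_trans IJ JS.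
  apply/commensurableE => //; split=> //.
  by apply: coset_finite1 => //; apply: genS.
split; first by exists J'.
by apply/commensurableE => //; split; apply: coset_finite1.
Qed.

(** Up to factors in W_J and W_J', the element w normalises W_I for some I with
    W_I of finite index in W_J, hence here in W_J' too: from W_J', pass to W_I,
    conjugate, and include in W_J. *)
Lemma coset_finite_parabolicV J J' w : J `<=` S -> J' `<=` S ->
  coset_finite (gen J') 1 (gen J) -> coset_finite (gen J) w (gen J') ->
  coset_finite (gen J') w^-1 (gen J).
Proof.
move=> JS J'S fJ'J /(coset_finite_parabolic bn_folding_system finS JS J'S).
move=> [I [a [b [[IJ IJ'] fI Ja J'b]]]]; set x := a * w * b => xI.
have sI := gen_subgroup I; have sJ := gen_subgroup J; have sJ' := gen_subgroup J'.
have fx : coset_finite (gen J') x^-1 (gen J).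
  have fJ'I : coset_finite (gen J') 1 (gen I).
    by rewrite -(mulg1 1); apply: (coset_finite_trans sJ) fJ'J fI.
  rewrite -(mul1g x^-1); apply: (coset_finite_trans sI) fJ'I _ => //.
  rewrite -(mulg1 x^-1); apply: (@coset_finite_trans _ _ _ (gen I)) => //.
    apply: coset_finite_sub => // h Ih; rewrite invgK.
    have : gen (conjugate x (conjugate x^-1 I)) (x * h * x^-1).
      by apply: gen_conjugate; rewrite xI.
    by rewrite conjugateM mulgV conjugate1.
  by apply: coset_finite1 => //; apply: genS.
apply/(coset_finite_shift _ sJ' sJ (subgroup_V sJ' J'b) (subgroup_V sJ Ja)).
by move: fx; rewrite /x; gsimp.
Qed.

Lemma coset_finite_parabolic_le J J' w : J `<=` S -> J' `<=` S ->
  coset_finite (gen J) w (gen J') -> coset_finite (gen J) 1 (gen J').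
Proof.
move=> JS J'S /(coset_finite_parabolic bn_folding_system finS JS J'S).
move=> [I [_ [_ [[IJ IJ'] fI _ _ _]]]].
rewrite -(mulg1 1); apply: (coset_finite_trans (gen_subgroup I)) fI _.
  exact: gen_subgroup.
by apply: coset_finite1; [exact: gen_subgroup | exact: genS].
Qed.

End BruhatDecomposition.

Theorem theorem4p1 (G : groupType) (B N : set G)
    (nT : normal (B `&` N) N) (S : set (quotient nT)) :
  bn_pair S -> commensurated B -> finite_set S ->
  forall J J' : set (quotient nT), J `<=` S -> J' `<=` S ->
  (forall g : G,
     virtually_contained (conjugate g (std_parabolic J)) (std_parabolic J') ->
     class_le (class_of S (gen J)) (class_of S (gen J')) /\
     (class_of S (gen J) = class_of S (gen J') <->
      commensurable (conjugate g (std_parabolic J)) (std_parabolic J'))) /\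
  (class_le (class_of S (gen J)) (class_of S (gen J')) ->
   virtually_contained (std_parabolic J) (std_parabolic J')).
Proof.
move=> bn commB finS J J' JS J'S.
have sP := subgroup_std_parabolic bn JS; have sP' := subgroup_std_parabolic bn J'S.
have reduce w g K K' := @coset_finite_std_parabolic _ _ _ _ _ bn commB K K' w g.
split=> [g|].
  rewrite virtually_contained_conjugateE // commensurable_conjugateE //.
  have [w wg] := bruhat_decomposition bn g^-1%g.
  have wVg := dcV bn wg; rewrite invgK in wVg.
  rewrite (reduce w) // (reduce w^-1%g g J' J) // => fw.
  have le := coset_finite_parabolic_le bn finS JS J'S fw.
  rewrite class_leE // class_of_eqE //; split=> //; split=> [[_ ge]|[_ fV]].
    by split=> //; apply: (coset_finite_parabolicV bn).
  by split=> //; apply: (coset_finite_parabolic_le bn finS J'S JS fV).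
rewrite class_leE // virtually_containedE // => le.
apply/(reduce 1%g) => //; apply/(dc1P bn); apply: subgroup_1.
by case: bn.
Qed.
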